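(* There exist absolute constants $c, C > 0$ such that the following holds. Let $q$ be a prime power, let $r \ge 1$ and $d \ge 5$ be integers, and let $C_0$ be an optimal LRC with locality $r$ over $\mathbb{F}_q$, of length $n$, dimension $k$ and minimum distance $d$ (so $d = n-k-\lceil k/r\rceil + 2$). If $n \ge c\, d r^2$, then $$n \le C\, d\, q^3 \quad\text{if } 4 \nmid d, \qquad\text{and}\qquad n \le C\, d\, q^{3+\frac{4}{d-4}} \quad\text{if } 4 \mid d.$$
   Context: All codes are linear. An $[n,k,d]_q$ code is a linear subspace of $\mathbb{F}_q^n$ of dimension $k\ge 1$ and minimum Hamming distance $d$. For a code $C\subseteq \mathbb{F}_q^n$, an index $i\in\{1,\dots,n\}$ and $\alpha\in\mathbb{F}_q$, let $C(i,\alpha)=\{(c_1,\dots,c_n)\in C : c_i=\alpha\}$, and for $I\subseteq\{1,\dots,n\}\setminus\{i\}$ let $C_I(i,\alpha)$ be the projection of $C(i,\alpha)$ on the coordinates in $I$. A set $R\subseteq\{1,\dots,n\}$ containing $i$ is a recovery set for $i$ if $C_{R\setminus\{i\}}(i,\alpha)\cap C_{R\setminus\{i\}}(i,\beta)=\emptyset$ for all $\alpha\ne\beta$ in $\mathbb{F}_q$. The code $C$ is a locally repairable code (LRC) with locality $r$ if every $i\in\{1,\dots,n\}$ has a recovery set of size $r+1$. Every linear $[n,k,d]_q$ LRC with locality $r$ satisfies the Singleton-type bound $d\le n-k-\lceil k/r\rceil+2$; it is called optimal if equality holds. *)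

(* Defs.v *)
From HB Require Import structures.
From mathcomp Require Import all_boot all_order all_algebra.

Set Implicit Arguments.
Unset Strict Implicit.
Unset Printing Implicit Defensive.

Import Order.TTheory GRing.Theory Num.Theory.
Local Open Scope ring_scope.

Section LinearCodes.
Variables (F : finFieldType) (n : nat).
Implicit Types (C : {vspace 'rV[F]_n}) (i : 'I_n) (a b : F).
Implicit Types (I S : {set 'I_n}).

Definition hamming_dist (u v : 'rV[F]_n) : nat :=
  #|[set i | u ord0 i != v ord0 i]|.

Definition is_min_dist C (d : nat) : Prop :=
  (exists u v, [/\ u \in C, v \in C, u != v & hamming_dist u v = d]) /\
  (forall u v, u \in C -> v \in C -> u != v -> (d <= hamming_dist u v)%N).

Definition is_code C (k d : nat) : Prop :=
  [/\ (1 <= k)%N, \dim C = k & is_min_dist C d].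

Definition fiber C i a : {set 'rV[F]_n} := [set c | (c \in C) && (c ord0 i == a)].

(* The coordinates in [I] are listed in the order of [enum I]. *)
Definition proj I (c : 'rV[F]_n) : 'rV[F]_#|I| :=
  colsub (fun j : 'I_#|I| => enum_val j) c.

Definition proj_fiber C I i a : {set 'rV[F]_#|I|} := proj I @: fiber C i a.

Definition recovery_set C i S : Prop :=
  i \in S /\
  forall a b, a != b ->
    proj_fiber C (S :\ i) i a :&: proj_fiber C (S :\ i) i b = set0.

Definition has_locality C (r : nat) : Prop :=
  forall i, exists S, recovery_set C i S /\ #|S| = r.+1.

(* The Singleton-type equality is stated over [int], since subtraction on [nat]
   is truncated. *)
Definition is_optimal_LRC C (k d r : nat) : Prop :=
  [/\ is_code C k d, has_locality C r &
      d%:Z = n%:Z - k%:Z - Num.ceil (k%:R / r%:R : rat) + 2].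

End LinearCodes.

(* Main.v *)
Require Import Defs.
From HB Require Import structures.
From mathcomp Require Import all_boot all_order all_algebra.
From mathcomp Require Import reals exp.
From mathcomp Require Import zify lra.

Set Implicit Arguments.
Unset Strict Implicit.
Unset Printing Implicit Defensive.

Import Order.TTheory GRing.Theory Num.Theory.
Local Open Scope ring_scope.

(** Put [m = ceil (k / r)]. Recovery sets give [m] linearly independent dual
    words of weight at most [r + 1]. Optimality forces their supports to cover
    at least [k + m] coordinates, so they overlap in fewer than [r] places and
    all but about [r] of these coordinates meet exactly one of the words.
    Keeping one such coordinate per word as a representative, every remaining
    one, [y], carries a vector of weight 2, supported on [y] and a
    representative and orthogonal to the [m] words. Combinations of at most
    [(d - 1) / 4] of these vectors, which may be shifted by multiples of one
    further vector when [d - 1] is 2 or 3 modulo 4, lie in distinct cosets of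
    the code inside the orthogonal of the [m] words. There are only [q ^ (d - 2)]
    such cosets, and comparing the two counts bounds [n]. *)

(** * Supports and Hamming weight *)

Section Weight.
Variables (F : finFieldType) (n : nat).
Implicit Types (x y : 'rV[F]_n).

Definition supp x : {set 'I_n} := [set i | x ord0 i != 0].

Lemma suppB x y : supp (x - y) \subset supp x :|: supp y.
Proof.
apply/subsetP => i; rewrite !inE !mxE; apply: contraR; rewrite negb_or !negbK.
by move=> /andP[/eqP -> /eqP ->]; rewrite subrr.
Qed.

Lemma suppD x y : supp (x + y) \subset supp x :|: supp y.
Proof.
apply/subsetP => i; rewrite !inE !mxE; apply: contraR; rewrite negb_or !negbK.
by move=> /andP[/eqP -> /eqP ->]; rewrite addr0.
Qed.

Lemma card_suppB x y : (#|supp (x - y)| <= #|supp x| + #|supp y|)%N.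
Proof. exact: leq_trans (subset_leq_card (suppB x y)) (leq_card_setU _ _). Qed.

Lemma card_suppD x y : (#|supp (x + y)| <= #|supp x| + #|supp y|)%N.
Proof. exact: leq_trans (subset_leq_card (suppD x y)) (leq_card_setU _ _). Qed.

Lemma supp0 : supp 0 = set0.
Proof. by apply/setP => i; rewrite !inE mxE eqxx. Qed.

Lemma suppZ (a : F) x : supp (a *: x) \subset supp x.
Proof.
by apply/subsetP => i; rewrite !inE mxE mulf_eq0 negb_or => /andP[].
Qed.

Lemma card_supp_sum (I : finType) (f : I -> 'rV[F]_n) (w : nat) :
  (forall i, #|supp (f i)| <= w)%N -> (#|supp (\sum_i f i)| <= #|I| * w)%N.
Proof.
move=> fw; apply: (@leq_trans (\sum_i #|supp (f i)|)); last first.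
  by rewrite -sum_nat_const leq_sum.
apply: (big_ind2 (fun x m => #|supp x| <= m)%N) => [|x m y p xm yp|//].
  by rewrite supp0 cards0.
exact: leq_trans (card_suppD x y) (leq_add xm yp).
Qed.

Lemma hamming_dist_supp x y : hamming_dist x y = #|supp (x - y)|.
Proof. by apply: eq_card => i; rewrite !inE !mxE subr_eq0. Qed.

End Weight.

(** * Generator matrices, and dual words from recovery sets *)

Section Generator.
Variables (F : finFieldType) (n : nat).

Lemma generator_matrix (C : {vspace 'rV[F]_n}) :
  exists G : 'M[F]_(\dim C, n),
    row_free G /\ forall c, (c \in C) = (c <= G)%MS.
Proof.
pose G := \matrix_i (vbasis C)`_i : 'M[F]_(\dim C, n).
have GE (u : 'rV_(\dim C)) : u *m G = \sum_i u ord0 i *: (vbasis C)`_i.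
  by rewrite mulmx_sum_row; apply: eq_bigr => i _; rewrite rowK.
exists G; split.
  apply: inj_row_free => u; rewrite GE => u0.
  have /freeP/(_ _ u0) H := basis_free (vbasisP C).
  by apply/rowP => i; rewrite mxE H.
move=> c; apply/idP/submxP => [cC|[u ->]].
  exists (\row_i coord (vbasis C) i c); rewrite GE [LHS](coord_vbasis cC).
  by apply: eq_bigr => i _; rewrite mxE.
rewrite GE; apply: memv_suml => i _; apply: memvZ; apply: vbasis_mem.
by rewrite mem_nth // size_tuple.
Qed.

(** By duality, column [i] of [G] is a combination of the columns in [S :\ i]; this linear relation
    is the dual word, with coefficient 1 at [i]. *)
Lemma parity_check k (G : 'M[F]_(k, n)) (i : 'I_n) (S : {set 'I_n}) :
  i \in S ->
  (forall u : 'rV_k, (forall j, j \in S :\ i -> (u *m G) ord0 j = 0) ->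
    (u *m G) ord0 i = 0) ->
  exists w : 'rV[F]_n, [/\ G *m w^T = 0, w ord0 i != 0 & supp w \subset S].
Proof.
move=> iS rec.
(* Right multiplication by [D] zeroes all columns outside [S :\ i]. *)
pose D : 'M[F]_n := \matrix_(a, b) ((a == b) && (a \in S :\ i))%:R.
have DE m (A : 'M[F]_(m, n)) a b : (A *m D) a b = A a b * (b \in S :\ i)%:R.
  rewrite mxE (bigD1 b) //= mxE eqxx /= big1 ?addr0 // => j /negPf jb.
  by rewrite mxE jb /= mulr0.
have : ((col i G)^T <= (G *m D)^T)%MS.
  rewrite submxE; apply/eqP; apply/rowP => j.
  (* Each column of the cokernel is a message [u] whose codeword vanishes on [S :\ i], so [rec]
     applies to it. *)
  pose u := row j (cokermx (G *m D)^T)^T.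
  have uGD : u *m (G *m D) = 0.
    rewrite -row_mul (_ : _ *m _ = 0) ?row0 //.
    by apply: trmx_inj; rewrite trmx_mul trmxK mulmx_coker trmx0.
  rewrite [RHS]mxE -[RHS](rec u) => [|l lS].
    by rewrite !mxE; apply: eq_bigr => l _; rewrite !mxE mulrC.
  by move/matrixP/(_ ord0 l): uGD; rewrite mulmxA DE lS mulr1 => ->; rewrite mxE.
case/submxP => z Gz.
exists (delta_mx ord0 i - z *m D); split.
- have DT : D^T = D.
    by apply/matrixP => a b; rewrite !mxE eq_sym; case: eqP => // ->.
  rewrite linearB /= mulmxBr trmx_delta -colE trmx_mul DT mulmxA.
  by rewrite -[G *m D]trmxK -trmx_mul -Gz trmxK subrr.
- by rewrite mxE [X in X + _]mxE [X in _ + X]mxE DE !inE !eqxx /= mulr0 subr0 oner_eq0.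
apply/subsetP => j; rewrite inE; apply: contraR => jS.
rewrite mxE [X in X + _]mxE [X in _ + X]mxE DE !inE (negPf jS) andbF mulr0 subr0.
by have /negPf-> : j != i by [apply: contraNneq jS => ->]; rewrite andbF eqxx.
Qed.

(** A codeword vanishing on [S :\ i] has the same projection as the zero word, so disjointness
    forces it to vanish at [i] too. *)
Lemma recovery_check (C : {vspace 'rV[F]_n}) k (G : 'M[F]_(k, n)) i S :
  (forall c, (c \in C) = (c <= G)%MS) -> recovery_set C i S ->
  exists w : 'rV[F]_n, [/\ G *m w^T = 0, w ord0 i != 0 & supp w \subset S].
Proof.
move=> CG [iS rec]; apply: parity_check => // u u0; apply/eqP.
apply/negPn/negP => ui.
have u0i : 0 != (u *m G) ord0 i by rewrite eq_sym.
move/setP/(_ (proj (S :\ i) 0)): (rec _ _ u0i).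
rewrite in_set0 => /negP; apply; rewrite inE; apply/andP; split.
  by apply: imset_f; rewrite inE mem0v mxE eqxx.
apply/imsetP; exists (u *m G); first by rewrite inE CG submxMl eqxx.
by apply/rowP => j; rewrite mxE [RHS]mxE u0 ?enum_valP // mxE.
Qed.

End Generator.

(** * Independent dual words of low weight and their supports *)

Section Checks.
Variables (F : finFieldType) (n : nat).

Definition msupp m (W : 'M[F]_(m, n)) : {set 'I_n} :=
  \bigcup_j supp (row j W).

Lemma notin_msupp m (W : 'M[F]_(m, n)) i j : i \notin msupp W -> W j i = 0.
Proof.
move=> iW; apply/eqP; apply: contraNT iW => Wji; apply/bigcupP.
by exists j; rewrite // inE mxE.
Qed.

Lemma card_msupp m (W : 'M[F]_(m, n)) :
  (#|msupp W| <= \sum_j #|supp (row j W)|)%N.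
Proof.
apply: (big_ind2 (fun (A : {set 'I_n}) s => #|A| <= s)%N) => [|A s B p As Bp|//].
  by rewrite cards0.
exact: leq_trans (leq_card_setU A B) (leq_add As Bp).
Qed.

(** Greedy choice: the first [m - 1] rows leave some coordinate [i] uncovered, and a check through
    [i] is independent of them because they all vanish there. *)
Lemma independent_checks k (G : 'M[F]_(k, n)) r :
  (forall i, exists w : 'rV[F]_n,
     [/\ G *m w^T = 0, w ord0 i != 0 & (#|supp w| <= r)%N]) ->
  forall m, (m.-1 * r < n)%N ->
  exists W : 'M[F]_(m, n),
    [/\ row_free W, G *m W^T = 0 & forall j, (#|supp (row j W)| <= r)%N].
Proof.
move=> loc; elim=> [_|m IHm mr].
  exists 0; split=> [||[]//]; last by rewrite trmx0 mulmx0.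
  by apply: inj_row_free => u _; rewrite thinmx0.
have [|W [Wfree GW Wr]] := IHm; first by apply: leq_ltn_trans mr; nia.
have [i iW] : exists i, i \notin msupp W.
  apply/existsP; rewrite -negb_forall; apply/negP => /forallP iW.
  have : (n <= #|msupp W|)%N.
    by rewrite -[n in (n <= _)%N]card_ord; apply: subset_leq_card; apply/subsetP.
  apply/negP; rewrite -ltnNge; apply: leq_ltn_trans (card_msupp W) _.
  apply: leq_ltn_trans mr; rewrite -[X in (_ <= X * _)%N]card_ord -sum_nat_const.
  exact: leq_sum.
have [w [Gw wi wr]] := loc i.
rewrite -[m.+1]/(1 + m)%N; exists (col_mx w W); split.
- apply: inj_row_free => u.
  rewrite -[u]hsubmxK mul_row_col => uW.
  have l0 : lsubmx u = 0.
    move/matrixP/(_ ord0 i): uW; rewrite !mxE big_ord1.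
    rewrite [X in _ + X]big1 => [|j _]; last by rewrite (notin_msupp j iW) mulr0.
    move/eqP; rewrite addr0 mulf_eq0 (negPf wi) orbF => /eqP l0.
    by apply/rowP => j; rewrite ord1 l0 mxE.
  move: uW; rewrite l0 mul0mx add0r => /eqP.
  by rewrite mulmx_free_eq0 // => /eqP ->; rewrite row_mx0.
- by rewrite tr_col_mx mul_mx_row Gw GW row_mx0.
move=> j; have [j' ->|j' ->] := split_ordP j.
  by rewrite rowKu ord1 row_id.
by rewrite rowKd.
Qed.

(* Otherwise the restrictions of [G] and [W] to a set of size [k + m - 1]
   containing the support of [W] would be full-rank and mutually orthogonal. *)
Lemma msupp_lower_bound k m (G : 'M[F]_(k, n)) (W : 'M[F]_(m, n)) d :
  (forall u : 'rV_k, u != 0 -> (d <= #|supp (u *m G)|)%N) ->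
  row_free W -> G *m W^T = 0 -> (0 < d)%N -> (k + m + d = n + 2)%N ->
  (k + m <= #|msupp W|)%N.
Proof.
move=> Gd Wfree GW d0 dE; rewrite leqNgt; apply/negP => Wsmall.
have : (d.-1 <= #|~: msupp W|)%N.
  by have := cardsC (msupp W); rewrite card_ord; lia.
case/card_geqP => s [s_uniq s_size sW].
pose A := ~: [set x in s].
have WA : msupp W \subset A.
  apply/subsetP => x; rewrite !inE; apply: contraL => /sW.
  by rewrite inE.
have cs : #|[set x in s]| = d.-1.
  by rewrite cardsE -s_size; apply/card_uniqP.
have cA : (#|A| + d.-1 = n)%N.
  by have := cardsC [set x in s]; rewrite cs card_ord addnC.
pose f (j : 'I_#|A|) := enum_val j.
have fE j : j \in A -> exists l, j = f l.
  by move=> jA; exists (enum_rank_in jA j); rewrite /f enum_rankK_in.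
(* A codeword vanishing on [A] has weight at most [d - 1], hence is zero. *)
have G'free : row_free (colsub f G).
  apply: inj_row_free => u uG; apply/eqP; apply: contraT => /Gd.
  rewrite leqNgt => /negP; case.
  suff: supp (u *m G) \subset [set x in s].
    by move/subset_leq_card; rewrite cs -ltnS prednK.
  apply/subsetP => x; apply: contraLR => xs.
  have /fE[l ->] : x \in A by rewrite inE.
  move/rowP/(_ l): uG; rewrite inE negbK !mxE => uG; apply/eqP.
  by rewrite -[RHS]uG; apply: eq_bigr => i _; rewrite mxE.
have W'free : row_free (colsub f W).
  apply: inj_row_free => u uW; apply/eqP; rewrite -(mulmx_free_eq0 u Wfree).
  apply/eqP/rowP => x; rewrite [RHS]mxE; case: (boolP (x \in A)) => [/fE[l ->]|xA].
    move/rowP/(_ l): uW; rewrite !mxE => uW.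
    by rewrite -[RHS]uW; apply: eq_bigr => i _; rewrite mxE.
  rewrite mxE big1 // => i _; rewrite notin_msupp ?mulr0 //.
  by apply: contra xA => /(subsetP WA).
have : colsub f G *m (colsub f W)^T = 0.
  apply/matrixP => a b; move/matrixP/(_ a b): GW; rewrite !mxE => GW.
  rewrite -[RHS]GW [RHS](bigID (mem A)) /= [X in _ = _ + X]big1 => [|x xA].
    rewrite addr0 [RHS]big_enum_val; apply: eq_bigr => i _.
    by rewrite !mxE.
  rewrite mxE (notin_msupp (W := W)) ?mulr0 //.
  by apply: contra xA => /(subsetP WA).
move/mulmx0_rank_max; rewrite mxrank_tr (eqP G'free) (eqP W'free); lia.
Qed.

(* A column of [W] with a single nonzero entry, in row [j], is paired with a
   representative of row [j] of the same kind. *)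
Lemma private_coordinates m (W : 'M[F]_(m, n)) :
  exists (Y : {set 'I_n}) (v : 'I_n -> 'rV[F]_n),
  [/\ (2 * #|msupp W| <= \sum_j #|supp (row j W)| + m + #|Y|)%N,
      forall y, v y *m W^T = 0,
      forall y, (#|supp (v y)| <= 2)%N &
      {in Y &, forall y z, v y ord0 z = (y == z)%:R}].
Proof.
pose col_supp x := [set j | W j x != 0].
pose P := [set x | #|col_supp x| == 1]%N.
pose rep j := [pick x in P | W j x != 0].
pose Q := [set x | [exists j, rep j == Some x]].
have cQ : (#|Q| <= m)%N.
  rewrite -[m]card_ord -(card_imset _ (@Some_inj _)).
  apply: leq_trans (leq_imset_card rep _); apply: subset_leq_card.
  apply/subsetP => _ /imsetP[x + ->]; rewrite inE => /existsP[j /eqP <-].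
  exact: imset_f.
have cE : (\sum_j #|supp (row j W)| = \sum_x #|col_supp x|)%N.
  under eq_bigr do rewrite -sum1_card big_mkcond.
  under [RHS]eq_bigr do rewrite -sum1_card big_mkcond.
  rewrite exchange_big; apply: eq_bigr => x _; apply: eq_bigr => j _.
  by rewrite !inE mxE.
(* A covered coordinate outside [P] lies in at least two supports; one in [P] is counted once in
   each term. *)
have cP : (2 * #|msupp W| <= \sum_j #|supp (row j W)| + #|P|)%N.
  rewrite cE -!sum1_card big_distrr [(\sum_(i in P) _)%N]big_mkcond.
  rewrite [X in (X <= _)%N]big_mkcond -big_split /=; apply: leq_sum => x _.
  case: ifP => // /bigcupP[j _]; rewrite inE mxE => Wjx.
  have : (0 < #|col_supp x|)%N by apply/card_gt0P; exists j; rewrite inE.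
  by rewrite inE; case: eqP => [->|]//; case: #|_| => [|[]].
suff : forall y, exists v : 'rV[F]_n,
  [/\ v *m W^T = 0, (#|supp v| <= 2)%N &
    y \in P :\: Q -> {in P :\: Q, forall z, v ord0 z = (y == z)%:R}].
  case/fin_all_exists => v vP; exists (P :\: Q), v; split.
  - apply: leq_trans cP _; rewrite -addnA leq_add2l -(cardsID Q P) leq_add2r.
    exact: leq_trans (subset_leq_card (subsetIr P Q)) cQ.
  - by move=> y; have [] := vP y.
  - by move=> y; have [] := vP y.
  by move=> y z yP zP; have [_ _ ->] := vP y.
move=> y; case: (boolP (y \in P :\: Q)) => [|_]; last first.
  by exists 0; split; rewrite ?mul0mx ?supp0 ?cards0.
rewrite inE => /andP[yQ yP].
have /cards1P[j jE] : #|col_supp y| == 1%N by move: yP; rewrite inE.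
have WE x i : #|col_supp x| == 1%N -> W j x != 0 -> i != j -> W i x = 0.
  case/cards1P => l lE Wjx ij; apply/eqP; apply: contraNT ij => Wix.
  have : j \in col_supp x by rewrite inE.
  have : i \in col_supp x by rewrite inE.
  by rewrite lE !inE => /eqP-> /eqP->.
have Wjy : W j y != 0 by have := set11 j; rewrite -jE inE.
case repE : (rep j) => [x|]; last first.
  by move: repE; rewrite /rep; case: pickP => // /(_ y); rewrite yP Wjy.
have [xP Wjx] : x \in P /\ W j x != 0.
  by move: repE; rewrite /rep; case: pickP => // ? /andP[? ?] [<-].
have xQ : x \in Q by rewrite inE; apply/existsP; exists j; rewrite repE.
(* The coefficient cancels row [j]; every other row vanishes at both [x] and [y]. Since [x] is in
   [Q], it is invisible on [P :\: Q]. *)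
exists (delta_mx ord0 y - (W j y / W j x) *: delta_mx ord0 x); split.
- apply/rowP => i; rewrite mulmxBl -scalemxAl -!rowE !mxE.
  have [->|ij] := eqVneq i j; first by rewrite divfK // subrr.
  have -> : W i y = 0 by apply: WE; rewrite // jE cards1.
  have -> : W i x = 0 by apply: WE; move: xP; rewrite inE.
  by rewrite mulr0 subr0.
- apply: (@leq_trans #|[set y; x]|); last by rewrite cards2; case: (_ == _).
  apply: subset_leq_card; apply/subsetP => z; rewrite !inE !mxE eqxx /=.
  by case: (z == y) => //=; case: (z == x) => //=; rewrite mulr0 subrr eqxx.
move=> _ z; rewrite inE => /andP[zQ zP]; rewrite !mxE eqxx /= (eq_sym z y).
have -> : z == x = false by apply: contraNF zQ => /eqP ->.
by rewrite mulr0 subr0.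
Qed.

End Checks.

(** * Counting error patterns modulo the code *)

Section Packing.
Variables (F : finFieldType) (n k m : nat).
Variables (G : 'M[F]_(k, n)) (W : 'M[F]_(m, n)).
Hypotheses (Gfree : row_free G) (Wfree : row_free W) (GW : G *m W^T = 0).

(** The cosets of the row space of [G] through the [phi i] are disjoint and lie in the kernel of
    [W^T], of dimension [n - m]. *)
Lemma coset_packing (I : finType) (phi : I -> 'rV[F]_n) :
  (forall i, phi i *m W^T = 0) ->
  (forall i j, (phi i - phi j <= G)%MS -> i = j) ->
  (#|I| * #|F| ^ k <= #|F| ^ (n - m))%N.
Proof.
move=> phiW phi_inj; pose B := row_base (kermx W^T).
have BE (x : 'rV_n) : x *m W^T = 0 -> (x <= B)%MS.
  by move=> xW; rewrite eq_row_base; apply/sub_kermxP.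
pose h (p : I * 'rV[F]_k) := (phi p.1 + p.2 *m G) *m pinvmx B.
have hK p : h p *m B = phi p.1 + p.2 *m G.
  by rewrite mulmxKpV // BE // mulmxDl phiW -mulmxA GW mulmx0 addr0.
have h_inj : injective h.
  case=> i u [j w] E; have : h (i, u) *m B = h (j, w) *m B by rewrite E.
  rewrite !hK /= => E'.
  have ij : i = j.
    apply: phi_inj; apply/submxP; exists (w - u); rewrite mulmxBl.
    by apply/eqP; rewrite subr_eq addrAC -subr_eq opprK E' addrC.
  move: E'; rewrite ij => /addrI E'; congr (_, _).
  exact: row_free_inj E'.
have := leq_card _ h_inj; rewrite card_prod !card_mx !mul1n.
by rewrite mxrank_ker mxrank_tr (eqP Wfree).
Qed.

(** A pattern picks one position and a nonzero scalar in each of [t] blocks of size [s], plus free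
    scalars at [e] fixed positions. In a difference of two patterns a block costs weight at most 4,
    but a fixed position only 2, since its two multiples merge. The total stays below [d], so
    distinct patterns lie in distinct cosets. *)
Lemma error_count (Y : {set 'I_n}) (v : 'I_n -> 'rV[F]_n) d t s e :
  (forall u : 'rV_k, u != 0 -> (d <= #|supp (u *m G)|)%N) ->
  (forall y, v y *m W^T = 0) -> (forall y, #|supp (v y)| <= 2)%N ->
  {in Y &, forall y z, v y ord0 z = (y == z)%:R} ->
  (t * s + e <= #|Y|)%N -> (4 * t + 2 * e < d)%N ->
  ((s * #|F|.-1) ^ t * #|F| ^ e * #|F| ^ k <= #|F| ^ (n - m))%N.
Proof.
move=> Gd vW v2 vY tsY ted.
pose J := ('I_t * 'I_s + 'I_e)%type.
have cJ : (#|{: J}| <= #|Y|)%N by rewrite card_sum card_prod !card_ord.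
pose g (j : J) := enum_val (widen_ord cJ (enum_rank j)).
have gY j : g j \in Y by apply: enum_valP.
have vg i j : v (g i) ord0 (g j) = (i == j)%:R.
  rewrite vY //; congr (_%:R); congr (nat_of_bool _); apply/eqP/eqP => [|->//].
  by move/enum_val_inj/(congr1 val) => /= /val_inj/enum_rank_inj.
pose Fx := {x : F | x != 0}.
pose I := ({ffun 'I_t -> 'I_s * Fx} * 'rV[F]_e)%type.
pose phi (p : I) := \sum_b val (p.1 b).2 *: v (g (inl (b, (p.1 b).1)))
  + \sum_j p.2 ord0 j *: v (g (inr j)).
have phi_l (p : I) b i :
  phi p ord0 (g (inl (b, i))) = val (p.1 b).2 * ((p.1 b).1 == i)%:R.
  rewrite mxE !summxE [X in _ + X]big1 => [|j _]; last by rewrite mxE vg mulr0.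
  rewrite addr0 (bigD1 b) //= mxE vg big1 ?addr0 => [|c cb].
    by rewrite -[inl _ == _]/((b, _) == _) xpair_eqE eqxx.
  by rewrite mxE vg -[inl _ == _]/((c, _) == _) xpair_eqE (negPf cb) mulr0.
have phi_r (p : I) j : phi p ord0 (g (inr j)) = p.2 ord0 j.
  rewrite mxE !summxE big1 => [|b _]; last by rewrite mxE vg mulr0.
  rewrite add0r (bigD1 j) //= mxE vg eqxx mulr1 big1 ?addr0 // => l lj.
  by rewrite mxE vg -[inr _ == _]/(l == _) (negPf lj) mulr0.
have phi_inj : injective phi.
  move=> [f a] [f' a'] E; congr (_, _); last first.
    by apply/rowP => j; have := phi_r (f, a) j; rewrite E phi_r.
  apply/ffunP => b; have := phi_l (f, a) b (f b).1; rewrite E phi_l /= eqxx mulr1.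
  case: (f b) (f' b) => i [x x0] [i' [x' x'0]] /=.
  (* If the positions chosen in block [b] differed, the nonzero scalar [x] would be read as 0. *)
  case: eqP => [-> /eqP|_ /eqP]; rewrite ?mulr1 ?mulr0.
    by move/eqP => xx'; congr (_, _); apply: val_inj.
  by rewrite eq_sym (negPf x0).
have phi_supp p p' : (#|supp (phi p - phi p')| <= 4 * t + 2 * e)%N.
  rewrite /phi opprD addrACA -!sumrB.
  apply: leq_trans (card_suppD _ _) _; apply: leq_add.
    rewrite mulnC -[X in (_ <= X * _)%N]card_ord; apply: card_supp_sum => b.
    apply: leq_trans (card_suppB _ _) _.
    by apply: (@leq_add _ _ 2 2); apply: leq_trans (subset_leq_card (suppZ _ _)) (v2 _).
  rewrite mulnC -[X in (_ <= X * _)%N]card_ord; apply: card_supp_sum => j.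
  by rewrite -scalerBl; apply: leq_trans (subset_leq_card (suppZ _ _)) (v2 _).
have -> : ((s * #|F|.-1) ^ t * #|F| ^ e = #|{: I}|)%N.
  rewrite card_prod card_ffun card_prod !card_ord card_mx mul1n card_sig.
  by rewrite -(cardC1 (0 : F)).
apply: (coset_packing (phi := phi)) => [p|p p'].
  rewrite mulmxDl !mulmx_suml !big1 ?addr0 // => i _; rewrite -scalemxAl vW;
  exact: scaler0.
case/submxP => u uE; apply: phi_inj; apply/eqP; rewrite -subr_eq0 uE.
have [->|/Gd] := eqVneq u 0; first by rewrite mul0mx.
by rewrite -uE => dle; have := leq_trans dle (phi_supp p p'); rewrite leqNgt ted.
Qed.

End Packing.

(** * The packing inequality for optimal LRCs *)

Section OptimalLRC.
Variables (F : finFieldType) (n : nat) (C : {vspace 'rV[F]_n}) (k d r : nat).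
Hypotheses (r_gt0 : (0 < r)%N) (Copt : is_optimal_LRC C k d r).

(** Here [m] is the ceiling of [k / r], described without division or truncated subtraction. *)
Lemma optimal_LRC_parameters :
  exists m, [/\ k <= m * r, m * r < k + r & k + m + d = n + 2]%N.
Proof.
have [[k1 _ _] _ dE] := Copt.
have r0 : (0 : rat) < r%:R by rewrite ltr0n.
have /andP[] := ceil_itv (k%:R / r%:R : rat).
have : 0 <= Num.ceil (k%:R / r%:R : rat) by rewrite ceil_ge0 (@lt_le_trans _ _ 0) ?divr_ge0.
move: dE; case: (Num.ceil _) => // m dE _ lt le; exists m.
split; last by lia.
  by move: le; rewrite ler_pdivrMr // -natrM ler_nat.
by move: lt; rewrite ltr_pdivlMr // intrB mulrBl mul1r ltrBlDr -natrM -natrD ltr_nat.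
Qed.

(** Total weight at most [m * (r + 1)] and coverage at least [k + m] give
    [#|Y| >= 2 * k - m * r >= k - r + 1], enough room for the blocks. *)
Lemma optimal_LRC_packing t s e :
  (1 < d)%N ->
  (t * s + e + r <= k + 1)%N -> (4 * t + 2 * e < d)%N ->
  ((s * #|F|.-1) ^ t * #|F| ^ e <= #|F| ^ (d - 2))%N.
Proof.
move=> d_gt1 tse ted; have [m [km mk nE]] := optimal_LRC_parameters.
have [[k1 dimC [_ dist]] loc _] := Copt.
have [G [Gfree CG]] := generator_matrix C; rewrite dimC in G Gfree CG.
have Gd (u : 'rV_k) : u != 0 -> (d <= #|supp (u *m G)|)%N.
  rewrite -(mulmx_free_eq0 u Gfree) => uG.
  rewrite -[u *m G]subr0 -hamming_dist_supp.
  by apply: dist; rewrite ?mem0v // CG submxMl.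
have checks i : exists w : 'rV[F]_n,
    [/\ G *m w^T = 0, w ord0 i != 0 & (#|supp w| <= r.+1)%N].
  have [S [Srec Sr]] := loc i; have [w [Gw wi wS]] := recovery_check CG Srec.
  by exists w; split; rewrite // -Sr subset_leq_card.
have [|W [Wfree GW Wr]] := independent_checks checks (m := m).
  (* Indeed [(m - 1) * (r + 1) < k + m - 1 < n]. *)
  by clear -km mk nE d_gt1 k1; case: m km mk nE => [|m] /=; nia.
have U := msupp_lower_bound Gd Wfree GW (ltnW d_gt1) nE.
have [Y [v [Ybig vW v2 vY]]] := private_coordinates W.
have sW : (\sum_j #|supp (row j W)| <= m * r.+1)%N.
  by rewrite -[X in (_ <= X * _)%N]card_ord -sum_nat_const; apply: leq_sum.
have tsY : (t * s + e <= #|Y|)%N.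
  by move: Ybig U sW; clear -tse mk; move: (\sum_j _)%N => x; nia.
have := error_count Gfree Wfree GW Gd vW v2 vY tsY ted.
have -> : (n - m = d - 2 + k)%N by lia.
by rewrite expnD leq_pmul2r // expn_gt0 ltnW // card_finNzRing_gt1.
Qed.

End OptimalLRC.

(** * Choice of parameters and extraction of [t]-th roots *)

Theorem theorem1p1 (R : realType) :
  exists c C : R, [/\ 0 < c, 0 < C &
    forall (F : finFieldType) (n k d r : nat) (C0 : {vspace 'rV[F]_n}),
      (1 <= r)%N -> (5 <= d)%N ->
      is_optimal_LRC C0 k d r ->
      c * d%:R * r%:R ^+ 2 <= n%:R ->
      (~~ (4 %| d)%N -> n%:R <= C * d%:R * #|F|%:R ^+ 3) /\
      ((4 %| d)%N ->
         n%:R <= C * d%:R * (#|F|%:R `^ (3 + 4 / (d%:R - 4))))].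
Proof.
(* The 4 lets [n] absorb the losses in [n_le]; the 2 comes from [q <= 2 * (q - 1)], as [4 * t <= d]
   absorbs the factor of [n_le]. *)
exists 4, 2; split=> // F n k d r C0 r_gt0 d_ge5 Copt n_big.
set q := #|F|.
have q_gt1 : (1 < q)%N by exact: card_finNzRing_gt1.
have {}n_big : (4 * d * r ^ 2 <= n)%N.
  by move: n_big; rewrite -natrX -!natrM ler_nat.
have d_gt1 : (1 < d)%N by lia.
have [m [km mk nE]] := optimal_LRC_parameters r_gt0 Copt.
have k_gt0 : (0 < k)%N by have [[]] := Copt.
(* The largest [t] with [4 * t < d]; a remainder of at least 2 leaves room for one fixed
   position. *)
pose t := (d.-1 %/ 4)%N; pose e : nat := (2 <= d.-1 %% 4)%N.
have t_gt0 : (0 < t)%N by rewrite divn_gt0 //; lia.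
have dE : d = (4 * t + d.-1 %% 4).+1.
  by rewrite mulnC -divn_eq prednK //; lia.
have rho_lt : (d.-1 %% 4 < 4)%N by rewrite ltn_mod.
have e_le1 : (e <= 1)%N by exact: leq_b1.
pose s := ((k + 1 - r - e) %/ t)%N.
(* Since [m <= k], [k] is about [n / 2] or more; rounding and the terms [r], [e], [d] cost at most
   another factor 2. *)
have n_le : (n <= 4 * (t * s))%N.
  have mk' : (m <= k)%N by nia.
  have : (k + 1 - r - e < t * s + t)%N.
    by rewrite {1}(divn_eq (k + 1 - r - e) t) mulnC ltn_add2l ltn_mod.
  nia.
have pack : ((s * q.-1) ^ t * q ^ e <= q ^ (d - 2))%N.
  apply: (optimal_LRC_packing r_gt0 Copt d_gt1).
    have := leq_trunc_div (k + 1 - r - e) t; rewrite mulnC -/s; nia.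
  move: dE; rewrite /e; lia.
have qs : (s * q <= 2 * (s * q.-1))%N by nia.
split=> d4.
  (* The exponent [d - 2 - e] is at most [4 * t] unless [d - 1] is 3 modulo 4, that is, unless 4
     divides [d]. *)
  have pack' : ((s * q.-1) ^ t <= (q ^ 4) ^ t)%N.
    rewrite -(@leq_pmul2r (q ^ e)) ?expn_gt0 ?(ltnW q_gt1) //.
    apply: leq_trans pack _; rewrite -expnM -expnD leq_exp2l //.
    have rho : (d.-1 %% 4 != 3)%N by apply: contra d4 => /eqP; lia.
    by rewrite /e; lia.
  have {}pack' : (s * q.-1 <= q ^ 4)%N by rewrite -(leq_exp2r _ _ t_gt0).
  have s_le : (s <= 2 * q ^ 3)%N.
    by rewrite -(@leq_pmul2r q) ?(ltnW q_gt1) // -mulnA -expnSr; lia.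
  rewrite -natrX -!natrM ler_nat; apply: leq_trans n_le _.
  by move: (q ^ 3)%N s_le => q3; nia.
have rho : (d.-1 %% 4 = 3)%N by lia.
have dt : d = (4 * t + 4)%N by lia.
have qR : (0 : R) < q%:R by rewrite ltr0n (ltnW q_gt1).
have tR : (0 : R) < t%:R by rewrite ltr0n.
have dR : d%:R = 4 * t%:R + 4 :> R by rewrite {1}dt natrD natrM.
have -> : 3 + 4 / (d%:R - 4) = 3 + t%:R^-1 :> R.
  by by rewrite dR addrK invfM mulrA divff ?mul1r ?pnatr_eq0.
set Q : R := q%:R `^ _.
(* Now [d - 2 - e = 4 * t + 1], and the surplus 1 becomes [1 / t = 4 / (d - 4)] in the exponent
   after the [t]-th root. *)
have QE : (q%:R * Q) ^+ t = (q ^ (4 * t + 1))%:R.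
  rewrite exprMn -[Q ^+ t]powR_mulrn ?powR_ge0 // -powRrM mulrDl mulVf ?gt_eqF //.
  rewrite powRD ?(gt_eqF qR) ?implybT // powRr1 ?(ltW qR) //.
  rewrite -natrM powR_mulrn ?(ltW qR) // mulrA -exprD -exprSr natrX.
  by congr (_ ^+ _); lia.
have Q_gt0 : 0 < Q by exact: powR_gt0.
have pack' : (s * q.-1)%:R <= q%:R * Q.
  rewrite -(ler_pXn2r t_gt0) ?nnegrE ?ler0n ?mulr_ge0 ?ler0n ?(ltW Q_gt0) //.
  rewrite QE -natrX ler_nat -(@leq_pmul2r (q ^ e)) ?expn_gt0 ?(ltnW q_gt1) //.
  apply: leq_trans pack _; rewrite -expnD leq_exp2l //.
  by rewrite /e rho; lia.
have s_le : s%:R <= 2 * Q.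
  rewrite -(ler_pM2r qR) -natrM -mulrA [Q * _]mulrC.
  apply: le_trans (_ : (2 * (s * q.-1))%:R <= _); first by rewrite ler_nat.
  by rewrite natrM ler_pM2l.
apply: (@le_trans _ _ (4 * (t%:R * s%:R))); first by rewrite -!natrM ler_nat.
apply: (@le_trans _ _ (4 * (t%:R * (2 * Q)))).
  by rewrite ler_pM2l // ler_pM2l.
rewrite dR; nra.
Qed.
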